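(* For every integer $n \ge 1$, let $L(n)$ be the maximal (worst-case) number of comparisons used by the list-merging sort to sort $n$ elements. Then $L(n) \equiv 1 - m(n-1) \pmod 2$ for all $n \ge 1$.
   Context: For a non-negative integer $k$, $s_2(k)$ denotes the number of ones in the binary expansion of $k$. Define $\bar{t}(k) = 1$ if $s_2(k)$ is even and $\bar{t}(k)=0$ if $s_2(k)$ is odd. The sequence $m(n)$, $n \ge 0$, is defined by $m(2k) = \bar{t}(k)$ and $m(2k+1) = 0$ for all $k \ge 0$. List-merging sort: start with $n$ lists of size $1$, in a row. In each iteration, group the lists into consecutive pairs and merge the two lists in each pair; if the number of lists is odd, the last list is left unchanged. Thus after $k$ iterations (until a single list remains) there are lists of size $2^k$ and possibly one more (last) list of size at most $2^k$. Iterate until one list remains. Merging two sorted lists: compare the smallest elements of the two lists, remove the smaller one and put it next in the resulting list, and continue; when one list is exhausted the rest of the other is appended without comparisons. In the worst case, merging two non-empty lists with $N$ elements in total takes $N-1$ comparisons, and $L(n)$ is the sum of these worst-case counts over all merges performed. The sequence $L(n)$ is OEIS A003071, indexed from $n=1$: $0,1,3,5,9,11,14,17,25,27,30,33,38,\ldots$. *)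

(* Defs.v *)
From mathcomp Require Import all_boot.

Set Implicit Arguments.
Unset Strict Implicit.
Unset Printing Implicit Defensive.

(* The number of ones in the binary expansion of k. The digit of weight 2 ^ i
   is (k %/ 2 ^ i) %% 2; since k < 2 ^ k, it vanishes for i >= k. *)
Definition s2 (k : nat) : nat := \sum_(i < k) (k %/ 2 ^ i) %% 2.

Definition tbar (k : nat) : nat := if odd (s2 k) then 0 else 1.

Definition m (n : nat) : nat := if odd n then 0 else tbar n./2.

Section ListMergingSort.

Variables (T : Type) (leT : rel T).

(* The number of comparisons performed by the library function [merge leT]:
   one comparison of the heads per element output, and none once one of the
   two lists is exhausted. The recursion follows that of [merge]. *)
Fixpoint merge_cmps (l1 : seq T) : seq T -> nat :=
  if l1 is x1 :: l1' then
    fix merge_cmps_l1 (l2 : seq T) : nat :=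
      if l2 is x2 :: l2' then
        (if leT x1 x2 then merge_cmps l1' l2 else merge_cmps_l1 l2').+1
      else 0
  else fun _ => 0.

(* One iteration: consecutive pairs of lists are merged, and an unpaired last
   list is left unchanged. *)
Fixpoint merge_pass (ss : seq (seq T)) : seq (seq T) :=
  if ss is l1 :: l2 :: ss' then merge leT l1 l2 :: merge_pass ss' else ss.

Fixpoint pass_cmps (ss : seq (seq T)) : nat :=
  if ss is l1 :: l2 :: ss' then merge_cmps l1 l2 + pass_cmps ss' else 0.

(* A pass turns k lists into ceil(k / 2) lists, so a single list remains after
   at most [size s] passes; the passes that follow do nothing and cost 0. *)
Definition lmsort_cmps (s : seq T) : nat :=
  \sum_(k < size s) pass_cmps (iter k merge_pass [seq [:: x] | x <- s]).

End ListMergingSort.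

(* The worst case over all inputs of n elements. The comparisons made depend
   only on the relative order of the elements (equal elements allowed), so
   every input is represented by a tuple of n ranks in {0, ..., n - 1}. *)
Definition L (n : nat) : nat :=
  \max_(t : n.-tuple 'I_n) lmsort_cmps (fun i j : 'I_n => i <= j) t.

(* Main.v *)
Require Import Defs.
From mathcomp Require Import all_boot zify.

(** Merging two sorted lists costs at most one less than their total size, and
    every sorted list without repetitions can be split into two sorted lists of
    prescribed positive sizes attaining this bound. Undoing the passes one by
    one from the fully sorted list therefore gives an input on which all merges
    are simultaneously worst possible, so L n depends only on the list sizes.
    Before pass k there are q + 1 lists, q = (n - 1) %/ 2 ^ k, all of size 2 ^ k
    but the last; the pass does uphalf q merges, involving n elements if q is
    odd and q 2 ^ k (an even number) otherwise. There are n - 1 merges in all,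
    so L n = (n - 1) + n * s2 (n - 1) modulo 2. *)

Fixpoint shape_pass (sh : seq nat) : seq nat :=
  if sh is a :: b :: sh' then a + b :: shape_pass sh' else sh.

Fixpoint shape_cost (sh : seq nat) : nat :=
  if sh is a :: b :: sh' then (a + b).-1 + shape_cost sh' else 0.

Lemma seq_ind2 (A : Type) (P : seq A -> Prop) :
    P [::] -> (forall x, P [:: x]) ->
    (forall x y s, P s -> P [:: x, y & s]) ->
  forall s, P s.
Proof.
move=> P0 P1 P2 s; suff [] : P s /\ forall x, P (x :: s) by [].
by elim: s => [|x s [IHs IHxs]]; split=> // y; apply: P2.
Qed.

Section WorstCase.

Variables (T : Type) (leT : rel T).

(** As [leT] is an arbitrary relation, both conditions are needed for [merge] to output [x] before
    [y] whichever list holds [x]. *)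
Definition strict (x y : T) : bool := leT x y && ~~ leT y x.

Lemma leq_merge_cmps (l1 l2 : seq T) :
  merge_cmps leT l1 l2 <= (size l1 + size l2).-1.
Proof.
elim: l1 l2 => [|x l1 IH1] //= l2.
elim: l2 => [|y l2 IH2] //=.
case: ifP => _; last by move: IH2 => /=; lia.
by have := IH1 (y :: l2) => /=; lia.
Qed.

Lemma shape_merge_pass (ss : seq (seq T)) :
  shape (merge_pass leT ss) = shape_pass (shape ss).
Proof.
by elim/seq_ind2: ss => //= l1 l2 ss ->; rewrite size_merge size_cat.
Qed.

Lemma shape_iter_merge_pass k (ss : seq (seq T)) :
  shape (iter k (merge_pass leT) ss) = iter k shape_pass (shape ss).
Proof. by elim: k => //= k <-; rewrite shape_merge_pass. Qed.

Lemma leq_pass_cmps (ss : seq (seq T)) :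
  pass_cmps leT ss <= shape_cost (shape ss).
Proof.
by elim/seq_ind2: ss => //= l1 l2 ss IH; rewrite leq_add ?leq_merge_cmps.
Qed.

(** The least element goes in front of a part that still needs two or more elements, so neither part
    runs out before the last two elements meet: every output but the last costs a comparison. *)
Lemma unmerge (a b : nat) (s : seq T) :
    0 < a -> 0 < b -> size s = a + b -> pairwise strict s ->
  exists l1 l2 : seq T,
    [/\ size l1 = a, size l2 = b, pairwise strict l1 && pairwise strict l2,
        merge leT l1 l2 = s & merge_cmps leT l1 l2 = (a + b).-1].
Proof.
elim: s a b => [|x s IH] [|a] [|b] //= _ _ [sz_s] /andP[x_s s_sorted].
case: a => [|a] in sz_s *; last first.
  have [||||l1 [l2 [sz1 sz2 /andP[sorted1 sorted2] def_s cmps]]] :=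
    IH a.+1 b.+1 => //.
  move: x_s; rewrite -def_s all_merge => /andP[x_l1 x_l2].
  exists (x :: l1), l2; split; rewrite /= ?sz1 ?x_l1 ?sorted1 //.
    by case: l2 sz2 x_l2 {def_s cmps sorted2} => //= y l2 _ /andP[/andP[->]].
  case: l2 sz2 x_l2 cmps {def_s sorted2} => //= y l2 _ /andP[/andP[-> _] _] ->.
  by lia.
case: b => [|b] in sz_s *.
  case: s sz_s {IH s_sorted} x_s => [|y []] //= _ /andP[/andP[xy _] _].
  by exists [:: x], [:: y]; rewrite /= xy.
have [||||l1 [l2 [sz1 sz2 /andP[sorted1 sorted2] def_s cmps]]] :=
  IH 1 b.+1 => //.
move: x_s; rewrite -def_s all_merge => /andP[x_l1 x_l2].
exists l1, (x :: l2); split; rewrite /= ?sz2 ?x_l2 ?sorted1 //.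
  by case: l1 sz1 x_l1 {def_s cmps sorted1} => //= y l1 _ /andP[/andP[_ /negPf->]].
case: l1 sz1 x_l1 cmps {def_s sorted1} => //= y l1 _.
by move=> /andP[/andP[_ /negPf->] _] ->; lia.
Qed.

Lemma unmerge_pass (sh : seq nat) (ss' : seq (seq T)) :
    all (leq 1) sh -> all (pairwise strict) ss' -> shape ss' = shape_pass sh ->
  exists ss : seq (seq T),
    [/\ shape ss = sh, all (pairwise strict) ss, merge_pass leT ss = ss'
      & pass_cmps leT ss = shape_cost sh].
Proof.
elim/seq_ind2: sh ss' => [|a|a b sh IH] ss' /=.
- by case: ss' => // _ _ _; exists [::].
- by move=> _ ss'_sorted sz; exists ss'; case: ss' sz ss'_sorted => [|? []].
case: ss' => //= l ss' /and3P[a_gt0 b_gt0 sh_gt0] /andP[l_sorted ss'_sorted].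
case=> /unmerge[] // l1 [l2 [<- <- /andP[sorted1 sorted2] <- cmps]].
case/IH=> // ss [<- ss_sorted <- cost].
exists [:: l1, l2 & ss]; split=> //=; first by rewrite sorted1 sorted2.
by rewrite cmps cost.
Qed.

Lemma shape_pass_gt0 (sh : seq nat) :
  all (leq 1) sh -> all (leq 1) (shape_pass sh).
Proof.
elim/seq_ind2: sh => //= a b sh IH /and3P[a_gt0 _ /IH->].
by rewrite addn_gt0 a_gt0.
Qed.

(** The induction hypothesis undoes the later passes; [unmerge_pass] then undoes the first one. *)
Lemma unmerge_passes (K : nat) (sh : seq nat) (ss' : seq (seq T)) :
    all (leq 1) sh -> all (pairwise strict) ss' ->
    shape ss' = iter K shape_pass sh ->
  exists ss : seq (seq T),
    [/\ shape ss = sh, all (pairwise strict) ss,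
        iter K (merge_pass leT) ss = ss' &
        \sum_(k < K) pass_cmps leT (iter k (merge_pass leT) ss) =
          \sum_(k < K) shape_cost (iter k shape_pass sh)].
Proof.
move=> sh_gt0 ss'_sorted sz.
elim: K sh sh_gt0 sz => [|K IH] sh sh_gt0 sz.
  by exists ss'; rewrite !big_ord0.
rewrite iterSr in sz; have [ss1 [sh1 sorted1 def_ss' sum1]] :=
  IH _ (shape_pass_gt0 _ sh_gt0) sz.
have [ss [sh_ss ss_sorted def_ss1 cost]] := unmerge_pass _ _ sh_gt0 sorted1 sh1.
exists ss; split; rewrite ?iterSr ?def_ss1 // !big_ord_recl /= cost.
congr (_ + _); under [RHS]eq_bigr do rewrite -iterS iterSr.
by rewrite -sum1; apply: eq_bigr => k _; rewrite -iterS iterSr def_ss1.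
Qed.

Lemma shape_singletons (s : seq T) :
  shape [seq [:: x] | x <- s] = nseq (size s) 1.
Proof. by elim: s => //= x s ->. Qed.

Lemma singletons_of_shape (ss : seq (seq T)) n :
  shape ss = nseq n 1 -> [seq [:: x] | x <- flatten ss] = ss.
Proof.
by elim: ss n => [|[|x [|y l]] ss IH] [|n] //= [] /IH->.
Qed.

Lemma leq_lmsort_cmps (s : seq T) :
  lmsort_cmps leT s <=
    \sum_(k < size s) shape_cost (iter k shape_pass (nseq (size s) 1)).
Proof.
apply: leq_sum => k _; apply: leq_trans (leq_pass_cmps _) _.
by rewrite shape_iter_merge_pass shape_singletons.
Qed.

End WorstCase.

Lemma rcons_nseq (A : Type) n (x : A) : rcons (nseq n x) x = nseq n.+1 x.
Proof. by elim: n => //= n ->. Qed.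

(** For odd [q] the last list is paired with a list of size [d]; for even [q] it is left over. *)
Lemma shape_pass_rcons q d r :
  shape_pass (rcons (nseq q d) r) =
    rcons (nseq q./2 (d + d)) (if odd q then d + r else r).
Proof.
have [k] := ubnP q; elim: k q => // k IH [|[|q]] //= lt_qk.
by rewrite IH ?negbK //; lia.
Qed.

(** There are [uphalf q] merges; adding their number on the left avoids truncated subtraction. *)
Lemma shape_cost_rcons q d r : 0 < d ->
  shape_cost (rcons (nseq q d) r) + uphalf q = q * d + odd q * r.
Proof.
move=> d_gt0; have [k] := ubnP q; elim: k q => // k IH [|[|q]] //= lt_qk.
  by lia.
by have := IH q; rewrite uphalf_half negbK; lia.
Qed.

Lemma iter_shape_pass_rcons K q d r : q < 2 ^ K ->
  iter K shape_pass (rcons (nseq q d) r) = [:: q * d + r].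
Proof.
elim: K q d r => [|K IH] q d r; first by case: q.
rewrite expnS => lt_q; rewrite iterSr shape_pass_rcons IH; last by lia.
by congr [:: _]; rewrite -{3}[q]odd_double_half; case: odd; lia.
Qed.

(** With total size [N = q * d + r], the first pass contributes [odd q * N + odd q + q./2] modulo 2.
    The term [q./2] cancels against the induction hypothesis for [q./2], and [odd q * N] supplies
    the lowest binary digit of [q]. *)
Lemma odd_sum_shape_cost K q d r : 0 < d -> q < 2 ^ K ->
  odd (\sum_(k < K) shape_cost (iter k shape_pass (rcons (nseq q d) r))) =
    odd q (+) (odd (q * d + r) && odd (\sum_(i < K) (q %/ 2 ^ i) %% 2)).
Proof.
elim: K q d r => [|K IH] q d r d_gt0.
  by case: q => // _; rewrite !big_ord0 andbF.
rewrite expnS => lt_q; rewrite !big_ord_recl /= divn1 modn2.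
under eq_bigr => k _ do rewrite -iterS iterSr shape_pass_rcons.
under [in RHS]eq_bigr => i _ do rewrite expnS divnMA divn2.
rewrite !oddD IH; [|lia|lia].
have := congr1 odd (shape_cost_rcons q d r d_gt0).
(* A pass preserves the total size. *)
have -> : q./2 * (d + d) + (if odd q then d + r else r) = q * d + r.
  by rewrite -[in RHS](odd_double_half q); case: odd; lia.
rewrite uphalf_half !oddD !oddM !oddb.
by do 6!case: (odd _).
Qed.

Lemma sum_digits_s2 K k : k <= K -> \sum_(i < K) (k %/ 2 ^ i) %% 2 = s2 k.
Proof.
move=> le_kK; rewrite /s2 -!(big_mkord xpredT (fun i => (k %/ 2 ^ i) %% 2)).
rewrite (@big_cat_nat _ _ _ k) //= addnC big_nat big1 ?add0n // => i /andP[le_ki _].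
by rewrite divn_small // (leq_ltn_trans le_ki) // ltn_expl.
Qed.

Lemma s2_double k : s2 k.*2 = s2 k.
Proof.
(* The extra index lets the lowest digit, which is 0, be split off even when [k = 0]. *)
rewrite -(@sum_digits_s2 k.*2.+1 k.*2) // big_ord_recl /= divn1 modn2 odd_double.
under eq_bigr => i _ do rewrite expnS divnMA divn2 doubleK.
by rewrite sum_digits_s2 // -addnn leq_addr.
Qed.

Lemma L_shape n :
  L n = \sum_(k < n) shape_cost (iter k shape_pass (nseq n 1)).
Proof.
apply/eqP; rewrite eqn_leq; apply/andP; split.
  apply/bigmax_leqP => t _.
  by apply: leq_trans (leq_lmsort_cmps _ _ _) _; rewrite size_tuple.
case: n => [|n]; first by rewrite big_ord0.
pose le_ord (i j : 'I_n.+1) := i <= j.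
have enum_sorted : pairwise (strict _ le_ord) (enum 'I_n.+1).
  have : pairwise ltn (map val (enum 'I_n.+1)).
    by rewrite val_enum_ord -sorted_pairwise ?iota_ltn_sorted //; exact: ltn_trans.
  rewrite pairwise_map; apply: sub_pairwise => i j /= lt_ij.
  by rewrite /strict /le_ord -ltnNge lt_ij ltnW.
have [|||ss [sh_ss _ _ cost]] := @unmerge_passes _ le_ord n.+1 (nseq n.+1 1)
    [:: enum 'I_n.+1].
- by rewrite all_nseq orbT.
- by rewrite /= enum_sorted.
(* The [n.+1] singletons are seen as [q = n] lists of size 1 followed by a last one, also of size
   1. *)
- rewrite -rcons_nseq iter_shape_pass_rcons; last by rewrite ltnW // ltn_expl.
  by rewrite /shape /= size_enum_ord muln1 addn1.
have sz_ss : size (flatten ss) == n.+1.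
  by rewrite size_flatten sh_ss sumn_nseq mul1n.
apply: leq_trans (leq_bigmax (Tuple sz_ss)).
by rewrite /lmsort_cmps /= (singletons_of_shape _ _ _ sh_ss) (eqP sz_ss) cost.
Qed.

Theorem lemma10 (n : nat) (hn : 1 <= n) : L n = 1 - m (n - 1) %[mod 2].
Proof.
case: n hn => // n _; rewrite L_shape subn1 !modn2; congr nat_of_bool.
rewrite -rcons_nseq odd_sum_shape_cost //; last by rewrite ltnW // ltn_expl.
rewrite sum_digits_s2 // muln1 addn1 /= /m.
(* For odd [n] the length [n.+1] is even, so the digit term vanishes and the parity is 1; for even
   [n] it is the parity of [s2 n]. *)
case: (boolP (odd n)) => //= even_n.
have {1}-> : n = n./2.*2 by rewrite even_halfK.
by rewrite s2_double /tbar; case: odd.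
Qed.
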